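(* Let $\mathcal{T}:(M_1,g_1)\to(M_2,g_2)$ be a Riemannian map between Riemannian manifolds and let $p\in M_1$. Then $\mathcal{T}$ is h-isotropic at $p$ if and only if its second fundamental form $\nabla\mathcal{T}_*$ satisfies $$g_2\big((\nabla\mathcal{T}_* )(X_1,X_1),(\nabla\mathcal{T}_* )(X_1,X_2)\big)=0$$ for every pair of orthogonal vectors $X_1,X_2\in(\ker\mathcal{T}_{*p})^\perp$.
   Context: Riemannian map: a smooth map $\mathcal{T}:(M_1^m,g_1)\to(M_2^n,g_2)$ with $0<\operatorname{rank}\mathcal{T}<\min\{m,n\}$ such that $g_2(\mathcal{T}_*X,\mathcal{T}_*Y)=g_1(X,Y)$ for all $X,Y\in(\ker\mathcal{T}_* )^{\perp}$. Second fundamental form: $(\nabla\mathcal{T}_* )(X,Y)=\nabla^{\mathcal{T}}_X\mathcal{T}_*Y-\mathcal{T}_*(\nabla^{1}_XY)$, where $\nabla^1,\nabla^2$ are the Levi-Civita connections of $M_1,M_2$ and $\nabla^{\mathcal{T}}$ is the pullback of $\nabla^2$ along $\mathcal{T}$; it is symmetric and tensorial. h-isotropic at $p$: the quantity $\lambda(X)=\|(\nabla\mathcal{T}_* )(X,X)\|/\|\mathcal{T}_*X\|^2$ does not depend on the choice of nonzero $X\in(\ker\mathcal{T}_{*p})^\perp$. *)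

(* Defs.v *)
From HB Require Import structures.
From mathcomp Require Import all_boot all_order all_algebra.
From mathcomp Require Import all_classical all_reals all_analysis.
Set Implicit Arguments.
Unset Strict Implicit.
Unset Printing Implicit Defensive.
Import Order.TTheory GRing.Theory Num.Theory.
Import numFieldNormedType.Exports.
Local Open Scope classical_set_scope.
Local Open Scope ring_scope.

(* Meant for [U] open and [V] finite-dimensional, where [C^k.+1] is equivalent
   to being differentiable with all directional derivatives of class [C^k]. *)
Fixpoint classC (R : realType) (V W : normedModType R) (k : nat) (U : set V)
    (f : V -> W) : Prop :=
  match k with
  | 0%N => forall x, U x -> {for x, continuous f}
  | k'.+1 => (forall x, U x -> differentiable f x) /\
             (forall v, classC k' U (fun x => 'd f x v))
  end.

Definition smooth (R : realType) (V W : normedModType R) (U : set V)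
    (f : V -> W) : Prop := forall k, classC k U f.

(* [cmap] and [cinv] are total functions; only their restrictions to [cdom]
   and to [cmap @` cdom] are meaningful. *)
Record chart (R : realType) (m : nat) (M : topologicalType) := Chart {
  cdom : set M;
  cmap : M -> 'rV[R]_m;
  cinv : 'rV[R]_m -> M;
  cdom_open : open cdom;
  cimg_open : open (cmap @` cdom);
  cmapK : forall q, cdom q -> cinv (cmap q) = q;
  cmap_continuous : forall q, cdom q -> {for q, continuous cmap};
  cinv_continuous : forall x, (cmap @` cdom) x -> {for x, continuous cinv} }.

(* The atlas need not be maximal.  [chart_at p] is a preferred chart around
   [p], used below to represent tangent vectors at [p]. *)
Record manifold (R : realType) (m : nat) := Manifold {
  points :> topologicalType;
  manifold_hausdorff : hausdorff_space points;
  manifold_second_countable : @second_countable points;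
  atlas : set (chart R m points);
  chart_at : points -> chart R m points;
  chart_at_atlas : forall p, atlas (chart_at p);
  chart_at_dom : forall p, cdom (chart_at p) p;
  atlas_compatible : forall c d, atlas c -> atlas d ->
    smooth (cmap c @` (cdom c `&` cdom d)) (cmap d \o cinv c) }.

(* A tangent vector at [p] is given by its coordinates in the chart
   [chart_at p]; the linear structure is that of ['rV[R]_m]. *)
Definition tangent (R : realType) (m : nat) (M : manifold R m) (p : M) : Type :=
  'rV[R]_m.

(* The coordinates, in an arbitrary chart [c] around [p], of [v : tangent p]. *)
Definition chart_coord (R : realType) (m : nat) (M : manifold R m)
    (c : chart R m M)
    (p : M) (v : tangent p) : 'rV[R]_m :=
  'd (cmap c \o cinv (chart_at p)) (cmap (chart_at p) p) v.

Section Smoothness.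
Variables (R : realType) (m : nat) (M : manifold R m).

Definition smooth_on (W : normedModType R) (U : set M) (f : M -> W) : Prop :=
  forall c, atlas c -> smooth (cmap c @` (cdom c `&` U)) (f \o cinv c).

Definition fun_smooth_near (p : M) (f : M -> R^o) : Prop :=
  exists U : set M, [/\ open U, U p & smooth_on U f].

(* The derivative [v f] of a scalar function [f] along [v]. *)
Definition vderiv (f : M -> R^o) (p : M) (v : tangent p) : R :=
  'd (f \o cinv (chart_at p)) (cmap (chart_at p) p) v.

End Smoothness.

Section AlongMap.
Variables (R : realType) (m n : nat) (M : manifold R m) (N : manifold R n).
Variable T : M -> N.

Definition smooth_map : Prop :=
  continuous T /\
  forall c, atlas c -> smooth_on (T @^-1` cdom c) (cmap c \o T).

Definition pushforward (p : M) (v : tangent p) : tangent (T p) :=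
  'd (cmap (chart_at (T p)) \o T \o cinv (chart_at p)) (cmap (chart_at p) p) v.

Definition map_rank (p : M) : nat := \rank (lin1_mx (@pushforward p)).

(* Sections of the pullback bundle [T^* TN]. *)
Definition field_along : Type := forall q : M, tangent (T q).

Definition field_smooth_near (p : M) (V : field_along) : Prop :=
  exists U : set M, [/\ open U, U p &
    forall c, atlas c ->
      smooth_on (U `&` T @^-1` cdom c) (fun q => chart_coord c (V q))].

End AlongMap.

Definition vector_field (R : realType) (m : nat) (M : manifold R m) : Type :=
  field_along (fun q : M => q).

Definition vfield_smooth_near (R : realType) (m : nat) (M : manifold R m)
    (p : M) (X : vector_field M) : Prop :=
  field_smooth_near p X.

Record metric (R : realType) (m : nat) (M : manifold R m) := Metric {
  inner :> forall p : M, tangent p -> tangent p -> R;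
  inner_sym : forall p (v w : tangent p), inner v w = inner w v;
  inner_linear : forall p (a : R) (u v w : tangent p),
    inner (a *: u + v : tangent p) w = a * inner u w + inner v w;
  inner_pos : forall p (v : tangent p), v != 0 -> 0 < inner v v;
  inner_smooth : forall p (X Y : vector_field M),
    vfield_smooth_near p X -> vfield_smooth_near p Y ->
    fun_smooth_near p (fun q => inner (X q) (Y q)) }.

(* Covariant derivatives of sections of [T^* TN].  They act on local sections:
   a section is a total function, required to be smooth only near the point
   where it is differentiated, and only its germ there matters. *)
Section Connections.
Variables (R : realType) (m n : nat) (M : manifold R m) (N : manifold R n).
Variable T : M -> N.

Definition covariant_op : Type :=
  forall p : M, tangent p -> field_along T -> tangent (T p).

Record is_connection (D : covariant_op) : Prop := IsConnection {
  conn_local : forall p (x : tangent p) (V W : field_along T),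
    field_smooth_near p V -> (\forall q \near p, V q = W q) ->
    D p x V = D p x W;
  conn_linear : forall p (a : R) (x y : tangent p) (V : field_along T),
    field_smooth_near p V ->
    D p (a *: x + y : tangent p) V = a *: D p x V + D p y V;
  conn_additive : forall p (x : tangent p) (V W : field_along T),
    field_smooth_near p V -> field_smooth_near p W ->
    D p x (fun q => V q + W q) = D p x V + D p x W;
  conn_leibniz : forall p (x : tangent p) (f : M -> R^o) (V : field_along T),
    fun_smooth_near p f -> field_smooth_near p V ->
    D p x (fun q => f q *: V q) = vderiv f x *: V p + f p *: D p x V;
  conn_smooth : forall p (X : vector_field M) (V : field_along T),
    vfield_smooth_near p X -> field_smooth_near p V ->
    field_smooth_near p (fun q => D q (X q) V) }.

End Connections.

Definition affine_op (R : realType) (m : nat) (M : manifold R m) : Type :=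
  covariant_op (fun q : M => q).

Record is_levi_civita (R : realType) (m : nat) (M : manifold R m)
    (g : metric M) (D : affine_op M) : Prop := IsLeviCivita {
  lc_connection : is_connection D;
  lc_metric : forall p (x : tangent p) (Y Z : vector_field M),
    vfield_smooth_near p Y -> vfield_smooth_near p Z ->
    vderiv (fun q => g q (Y q) (Z q)) x =
      g p (D p x Y) (Z p) + g p (Y p) (D p x Z);
  (* [D_X Y - D_Y X] and the Lie bracket [X, Y] agree as derivations. *)
  lc_torsion_free : forall p (X Y : vector_field M) (f : M -> R^o),
    vfield_smooth_near p X -> vfield_smooth_near p Y -> fun_smooth_near p f ->
    vderiv f (D p (X p) Y - D p (Y p) X : tangent p) =
      vderiv (fun q => vderiv f (Y q)) (X p) -
      vderiv (fun q => vderiv f (X q)) (Y p) }.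

Section RiemannianMaps.
Variables (R : realType) (m n : nat) (M1 : manifold R m) (M2 : manifold R n).
Variables (g1 : metric M1) (g2 : metric M2) (T : M1 -> M2).

Record is_pullback_connection (D2 : affine_op M2) (DT : covariant_op T) : Prop :=
  IsPullbackConnection {
  pullback_connection : is_connection DT;
  pullback_comp : forall p (x : tangent p) (Y : vector_field M2),
    vfield_smooth_near (T p) Y ->
    DT p x (fun q => Y (T q)) = D2 (T p) (pushforward T x) Y }.

(* The orthogonal complement of the kernel of the differential. *)
Definition horizontal (p : M1) : set (tangent p) :=
  [set v | forall w : tangent p, pushforward T w = 0 -> g1 p v w = 0].

Definition is_riemannian_map : Prop :=
  [/\ smooth_map T,
      forall p, (0 < map_rank T p < minn m n)%N &
      forall p (x y : tangent p), horizontal x -> horizontal y ->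
        g2 (T p) (pushforward T x) (pushforward T y) = g1 p x y].

Definition sff_field (D1 : affine_op M1) (DT : covariant_op T) (p : M1)
    (x : tangent p) (Y : vector_field M1) : tangent (T p) :=
  DT p x (fun q => pushforward T (Y q)) - pushforward T (D1 p x Y).

(* Some vector field, smooth near [p], whose value at [p] is [y]. *)
Definition extension (p : M1) (y : tangent p) : vector_field M1 :=
  xget (fun _ => 0 : 'rV[R]_m)
    [set Y : M1 -> 'rV[R]_m | vfield_smooth_near p (Y : vector_field M1) /\
                              Y p = y].

(* By tensoriality the choice of the extension is irrelevant. *)
Definition second_fundamental_form (D1 : affine_op M1) (DT : covariant_op T)
    (p : M1) (x y : tangent p) : tangent (T p) :=
  sff_field D1 DT x (extension y).

Definition vnorm (q : M2) (v : tangent q) : R := Num.sqrt (g2 q v v).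

Definition isotropy_ratio (D1 : affine_op M1) (DT : covariant_op T) (p : M1)
    (x : tangent p) : R :=
  vnorm (second_fundamental_form D1 DT x x) / vnorm (pushforward T x) ^+ 2.

Definition h_isotropic (D1 : affine_op M1) (DT : covariant_op T) (p : M1) : Prop :=
  forall x y : tangent p, horizontal x -> horizontal y -> x != 0 -> y != 0 ->
    isotropy_ratio D1 DT x = isotropy_ratio D1 DT y.

End RiemannianMaps.

(* Main.v *)
Require Import Defs.
From mathcomp Require Import all_boot all_order all_algebra.
From mathcomp Require Import all_classical all_reals all_analysis.
From HB Require Import structures.
From mathcomp Require Import ring lra.
Set Implicit Arguments.
Unset Strict Implicit.
Unset Printing Implicit Defensive.
Import Order.TTheory GRing.Theory Num.Theory.
Import numFieldNormedType.Exports.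
Local Open Scope classical_set_scope.
Local Open Scope ring_scope.

(* Write B for the second fundamental form.  Linearity of B in its first
   argument is an axiom of connections, so everything rests on symmetry.  Let y
   be the coordinates of a chart around T p, with coordinate fields E_k, and let
   T^k = y^k o T.  Expanding T_*Y = sum_k (Y T^k) E_k o T with the Leibniz rule
   gives
     B(X, Y) = sum_k X(Y T^k) E_k + sum_{k,l} (Y T^k)(X T^l) nabla_{E_l} E_k
               - T_*(nabla_X Y).
   The double sum is symmetric because nabla^2 is torsion free and the E_k
   commute; the rest is symmetric because torsion-freeness of nabla^1, tested on
   the functions T^k, says that the antisymmetric parts cancel.  No equality of
   mixed partial derivatives is needed.

   The rest is algebra: |B(x, x)|^2 is a quartic form on the horizontal space,
   and h-isotropy says that it is a multiple of |x|^4. *)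

(** * Open neighbourhoods *)

Lemma near_open (T : topologicalType) (U : set T) (P : T -> Prop) x :
  open U -> U x -> (forall y, U y -> P y) -> \forall y \near x, P y.
Proof. by move=> Uo Ux UP; apply: filterS (open_nbhs_nbhs (conj Uo Ux)). Qed.

Lemma nearE_open (T : topologicalType) (P : T -> Prop) (x : T) :
  (\forall y \near x, P y) -> exists U, [/\ open U, U x & forall y, U y -> P y].
Proof.
by rewrite -nbhs_nearE nbhsE => -[U [Uo Ux] UP]; exists U.
Qed.

(** * Functions of class C^k *)

Section Calculus.
Variable R : realType.
Implicit Types V W Z : normedModType R.

(** Differentials depend only on germs: [g] has the same first-order expansion at [x] as [f], and
    such an expansion determines the differential. Identities between charts hold only locally and
    enter derivatives through this lemma. *)
Lemma near_eq_is_diff V W (f g df : V -> W) x :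
  (\forall y \near x, f y = g y) -> is_diff x f df -> is_diff x g df.
Proof.
move=> fg fdf; have [fx dfE] := fdf.
have h : g \o shift x = cst (g x) + 'd f x +o_ 0 id.
  apply/eqaddoP => e e0.
  have /diff_locally/eqaddoP/(_ e e0) := fx.
  have fgx := fg; rewrite (near_shift 0) in fgx.
  apply: filterS2 fgx => y /=.
  rewrite !fctE /= subr0 => <-.
  by rewrite (nbhs_singleton fg).
have dc := diff_continuous fx.
have := diff_unique dc h => dgE.
split; last by rewrite dgE.
by apply/diff_locallyP; rewrite dgE; split.
Qed.

Lemma near_eq_differentiable V W (f g : V -> W) x :
  (\forall y \near x, f y = g y) -> differentiable f x -> differentiable g x.
Proof.
by move=> fg /differentiableP fx; have [] := near_eq_is_diff fg fx.
Qed.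

Lemma near_eq_diff V W (f g : V -> W) x :
  (\forall y \near x, f y = g y) -> differentiable f x ->
  'd f x = 'd g x :> (V -> W).
Proof.
by move=> fg /differentiableP fx; have [] := near_eq_is_diff fg fx.
Qed.

(** The equation [f x = y] lets [y] be written as [cmap d q] when [f x] is only provably equal to
    it. *)
Lemma is_diff_comp_at V W Z (f : V -> W)
    (g : W -> Z) x y : f x = y -> differentiable f x -> differentiable g y ->
  is_diff x (g \o f) ('d g y \o 'd f x).
Proof.
by move=> <- df dg; split; [exact: differentiable_comp|exact: diff_comp].
Qed.

Lemma classC_sub V W k (U U' : set V) (f : V -> W) :
  U' `<=` U -> classC k U f -> classC k U' f.
Proof.
move=> UU'; elim: k f => [|k IH] f /=; first by move=> h x /UU'; exact: h.
move=> [h1 h2]; split=> [x /UU'|v]; first exact: h1.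
exact/IH/h2.
Qed.

Lemma classC_eq V W k (U : set V) (f g : V -> W) :
  open U -> (forall x, U x -> f x = g x) -> classC k U f -> classC k U g.
Proof.
move=> Uo; elim: k f g => [|k IH] f g fg /=.
  move=> h x Ux; have fgx := near_open Uo Ux fg.
  have := h x Ux; rewrite /prop_for /continuous_at -(fg _ Ux).
  by apply: cvg_trans; apply: near_eq_cvg.
move=> [h1 h2]; split=> [x Ux|v].
  exact: near_eq_differentiable (near_open Uo Ux fg) (h1 _ Ux).
apply: IH (h2 v) => x Ux.
by rewrite (near_eq_diff (near_open Uo Ux fg) (h1 _ Ux)).
Qed.

Lemma classCS V W k (U : set V) (f : V -> W) : classC k.+1 U f -> classC k U f.
Proof.
elim: k f => [|k IH] f /=.
  by move=> [h1 _] x Ux; exact/differentiable_continuous/h1.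
by move=> [h1 h2]; split=> // v; apply/IH/h2.
Qed.

Lemma classC_cst V W k (U : set V) (a : W) : classC k U (fun=> a).
Proof.
elim: k a => [|k IH] a /=; first by move=> x _; exact: cst_continuous.
split=> [x _|v]; first exact: differentiable_cst.
rewrite (_ : (fun _ => _) = fun=> 0); first exact: IH.
by apply/funext => x; rewrite (diff_cst a x).
Qed.

Lemma classCD V W k (U : set V) (f g : V -> W) : open U ->
  classC k U f -> classC k U g -> classC k U (fun x => f x + g x).
Proof.
move=> Uo; elim: k f g => [|k IH] f g /=.
  by move=> hf hg x Ux; apply: continuousD; [exact: hf|exact: hg].
move=> [f1 f2] [g1 g2]; split=> [x Ux|v].
  by apply: differentiableD; [exact: f1|exact: g1].
apply: classC_eq (IH _ _ (f2 v) (g2 v)) => // x Ux.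
by rewrite (diffD (f1 _ Ux) (g1 _ Ux)).
Qed.

Lemma classC_sum V W k (U : set V) I (r : seq I) (f : I -> V -> W) : open U ->
  (forall i, classC k U (f i)) -> classC k U (fun x => \sum_(i <- r) f i x).
Proof.
move=> Uo h; elim: r => [|i r IH].
  rewrite (_ : (fun _ => _) = fun=> 0); first exact: classC_cst.
  by apply/funext => x; rewrite big_nil.
rewrite (_ : (fun _ => _) = fun x => f i x + \sum_(j <- r) f j x).
  exact: classCD.
by apply/funext => x; rewrite big_cons.
Qed.

(** Scaling is a continuous bilinear map, packaged as [b], so the product rule is its differential
    composed with that of the pair [(f, g)]. *)
Lemma is_diff_scale V W (f : V -> R^o) (g : V -> W) x :
  differentiable f x -> differentiable g x ->
  is_diff x (fun y => f y *: g y) (fun v => f x *: 'd g x v + 'd f x v *: g x).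
Proof.
move=> df dg.
have bil : bilinear_for
    (GRing.Scale.Law.clone _ _ *:%R _) (GRing.Scale.Law.clone _ _ *:%R _)
    ((fun a w => a *: w) : R^o -> W -> W).
  split=> [w a u v|u a w w'] /=; first by rewrite scalerDl scalerA.
  by rewrite scalerDr !scalerA mulrC.
pose bM := bilinear_isBilinear.Build R R^o W W _ _ _ bil.
pose b : {bilinear R^o -> W -> W} :=
  HB.pack ((fun a w => a *: w) : R^o -> W -> W) bM.
have bc : continuous (fun q : R^o * W => b q.1 q.2) by exact: scale_continuous.
have hb := differentiable_bilin (f x, g x) bc.
have hp := differentiable_pair df dg.
rewrite (_ : (fun y => f y *: g y) =
  (fun q : R^o * W => b q.1 q.2) \o (fun y => (f y, g y))) //.
split; first exact: differentiable_comp.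
rewrite (@diff_comp _ _ _ _ (fun y => (f y, g y)) _ _ hp hb) (diff_bilin _ bc).
by rewrite diff_pair.
Qed.

(** By the product rule the derivative is again a sum of products; in each of them [classCS] lowers
    the undifferentiated factor to the class of the other. *)
Lemma classCZ V W k (U : set V) (f : V -> R^o) (g : V -> W) : open U ->
  classC k U f -> classC k U g -> classC k U (fun x => f x *: g x).
Proof.
move=> Uo; elim: k f g => [|k IH] f g /=.
  by move=> hf hg x Ux; apply: continuousZ; [exact: hf|exact: hg].
move=> fk gk; have [f1 f2] := fk; have [g1 g2] := gk; split=> [x Ux|v].
  by have [] := is_diff_scale (f1 _ Ux) (g1 _ Ux).
apply: (@classC_eq _ _ _ _ (fun x => f x *: 'd g x v + 'd f x v *: g x)) => //.
  by move=> x Ux; have [_ ->] := is_diff_scale (f1 _ Ux) (g1 _ Ux).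
by apply: classCD => //; apply: IH => //; exact: classCS.
Qed.

Lemma classC_lin V W Z k (U : set V) (f : V -> W) (L : {linear W -> Z}) :
  open U -> continuous L -> classC k U f -> classC k U (L \o f).
Proof.
move=> Uo Lc; elim: k f => [|k IH] f /=.
  by move=> hf x Ux; apply: continuous_comp; [exact: hf|exact: Lc].
move=> [f1 f2]; split=> [x Ux|v].
  by apply: differentiable_comp; [exact: f1|exact: linear_differentiable].
apply: (@classC_eq _ _ _ _ (L \o (fun x => 'd f x v))); [by []| |exact: IH].
move=> x Ux /=.
by rewrite (diff_comp (f1 _ Ux) (linear_differentiable (f x) Lc)) /= diff_lin.
Qed.

Definition coordl n (i : 'I_n) : 'rV[R]_n -> R^o := fun v => v 0 i.

Lemma coordl_is_linear n (i : 'I_n) : linear (@coordl n i).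
Proof. by move=> a u v; rewrite /coordl !mxE. Qed.

HB.instance Definition _ n (i : 'I_n) :=
  GRing.isLinear.Build _ _ _ _ (@coordl n i) (@coordl_is_linear n i).

Lemma coordl_continuous n (i : 'I_n) : continuous (@coordl n i).
Proof. exact: coord_continuous. Qed.

Lemma linear_coordE n W (L : {linear 'rV[R]_n -> W}) (v : 'rV[R]_n) :
  L v = \sum_(i < n) v 0 i *: L (delta_mx 0 i).
Proof.
rewrite {1}[v]row_sum_delta linear_sum; apply: eq_bigr => i _.
by rewrite linearZ.
Qed.

(** The middle space is ['rV[R]_n] so that the chain rule can be expanded in the standard basis: the
    derivative is a finite sum of components of ['d f x v] times partial derivatives of [g] along
    [f], and the induction applies to the latter. *)
Lemma classC_comp V W n k (U : set V) (U' : set 'rV[R]_n) (f : V -> 'rV[R]_n)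
  (g : 'rV[R]_n -> W) : open U -> (forall x, U x -> U' (f x)) ->
  classC k U f -> classC k U' g -> classC k U (g \o f).
Proof.
move=> Uo UU'; elim: k f g UU' => [|k IH] f g UU' /=.
  by move=> hf hg x Ux; apply: continuous_comp; [exact: hf|exact/hg/UU'].
move=> fk gk; have [f1 f2] := fk; have [g1 g2] := gk; split=> [x Ux|v].
  by apply: differentiable_comp; [exact: f1|exact/g1/UU'].
apply: (@classC_eq _ _ _ _ (fun x => \sum_(i < n)
   coordl i ('d f x v) *: 'd g (f x) (delta_mx 0 i))) => //.
  move=> x Ux; rewrite (diff_comp (f1 _ Ux) (g1 _ (UU' _ Ux))) /=.
  by rewrite [RHS]linear_coordE.
apply: classC_sum => // i; apply: classCZ => //.
  exact: (@classC_lin _ _ _ _ _ (fun x => 'd f x v) (@coordl n i) Uo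
    (@coordl_continuous n i)).
apply: (@IH f (fun y => 'd g y (delta_mx 0 i))) => //.
exact: classCS.
Qed.

End Calculus.

(** * Smooth functions between normed spaces *)

Section Smooth.
Variable R : realType.
Implicit Types V W Z : normedModType R.

Lemma smooth_differentiable V W (U : set V) (f : V -> W) x :
  smooth U f -> U x -> differentiable f x.
Proof. by move=> /(_ 1%N) [h _] /h. Qed.

Lemma smooth_sub V W (U U' : set V) (f : V -> W) :
  U' `<=` U -> smooth U f -> smooth U' f.
Proof. by move=> UU' h k; apply: classC_sub UU' (h k). Qed.

Lemma smooth_eq V W (U : set V) (f g : V -> W) :
  open U -> (forall x, U x -> f x = g x) -> smooth U f -> smooth U g.
Proof. by move=> Uo fg h k; apply: classC_eq Uo fg (h k). Qed.

Lemma smooth_sum V W (U : set V) I (r : seq I) (f : I -> V -> W) : open U ->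
  (forall i, smooth U (f i)) -> smooth U (fun x => \sum_(i <- r) f i x).
Proof. by move=> Uo h k; apply: classC_sum Uo _ => i; exact: h. Qed.

Lemma smooth_scale V W (U : set V) (f : V -> R^o) (g : V -> W) : open U ->
  smooth U f -> smooth U g -> smooth U (fun x => f x *: g x).
Proof. by move=> Uo hf hg k; apply: classCZ. Qed.

Lemma smooth_coord V n (U : set V) (f : V -> 'rV[R]_n) (i : 'I_n) : open U ->
  smooth U f -> smooth U (fun x => f x 0 i : R^o).
Proof.
by move=> Uo hf k; apply: (classC_lin Uo (@coordl_continuous R n i) (hf k)).
Qed.

Lemma smooth_comp V W n (U : set V) (U' : set 'rV[R]_n) (f : V -> 'rV[R]_n)
  (g : 'rV[R]_n -> W) : open U -> (forall x, U x -> U' (f x)) ->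
  smooth U f -> smooth U' g -> smooth U (g \o f).
Proof. by move=> Uo UU' hf hg k; apply: classC_comp Uo UU' (hf k) (hg k). Qed.

Lemma smooth_diff V W (U : set V) (f : V -> W) v :
  smooth U f -> smooth U (fun x => 'd f x v).
Proof. by move=> h k; exact: (h k.+1).2. Qed.

(** In the standard basis the value at a moving vector is a finite sum of values at fixed vectors,
    with smooth coefficients. *)
Lemma smooth_apply V n W (U : set V) (L : V -> {linear 'rV[R]_n -> W})
  (X : V -> 'rV[R]_n) : open U ->
  (forall v, smooth U (fun x => L x v)) -> smooth U X ->
  smooth U (fun x => L x (X x)).
Proof.
move=> Uo hL hX.
rewrite (_ : (fun x => _) =
  fun x => \sum_(i < n) (X x 0 i : R^o) *: L x (delta_mx 0 i)).
  by apply: smooth_sum => // i; apply: smooth_scale => //; exact: smooth_coord.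
by apply/funext => x; rewrite [LHS]linear_coordE.
Qed.

End Smooth.

(** * Charts and smooth functions *)

Section Charts.
Variables (R : realType) (m : nat) (M : manifold R m).
Implicit Types (c d e : chart R m M) (q : M).

Lemma chart_img_open c (U : set M) :
  open U -> open (cmap c @` (cdom c `&` U)).
Proof.
move=> Uo; rewrite openE => _ [q [cq Uq] <-]; rewrite /interior.
have h1 : nbhs (cmap c q) (cmap c @` cdom c).
  by apply: open_nbhs_nbhs; split; [exact: cimg_open|exists q].
have h2 : nbhs (cmap c q) (cinv c @^-1` U).
  apply: (@cinv_continuous _ _ _ c (cmap c q)); first by exists q.
  by rewrite cmapK //; exact: open_nbhs_nbhs.
apply: filterS2 h1 h2 => x [r cr <-] /=; rewrite cmapK // => Ur.
by exists r.
Qed.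

(** The Jacobian of a change of charts. When [c] is [chart_at q] it is convertible to
    [chart_coord d], and several proofs below end by this conversion. *)
Definition transition c d q : {linear 'rV[R]_m -> 'rV[R]_m} :=
  'd (cmap d \o cinv c) (cmap c q).

Lemma transition_differentiable c d q : atlas c -> atlas d -> cdom c q ->
  cdom d q -> differentiable (cmap d \o cinv c) (cmap c q).
Proof.
move=> ac ad cq dq; apply: smooth_differentiable (atlas_compatible ac ad) _.
by exists q.
Qed.

(** Near [cmap c q] the map [f \o cinv c] factors through [cmap d \o cinv c], and the chain rule
    applies. With a coordinate map as [f] this yields the cocycle law for transitions. *)
Lemma chart_is_diff (W : normedModType R) (f : M -> W) c d q :
  atlas c -> atlas d -> cdom c q -> cdom d q -> differentiable (f \o cinv d) (cmap d q) ->
  is_diff (cmap c q) (f \o cinv c)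
    ('d (f \o cinv d) (cmap d q) \o transition c d q).
Proof.
move=> ac ad cq dq df.
have tr := transition_differentiable ac ad cq dq.
have E : (cmap d \o cinv c) (cmap c q) = cmap d q by rewrite /= cmapK.
have h := is_diff_comp_at E tr df.
apply: near_eq_is_diff h.
have := @chart_img_open c _ (cdom_open d) => io.
apply: (near_open io); first by exists q.
by move=> _ [r [cr dr] <-] /=; rewrite !cmapK.
Qed.

Lemma transition_id c q v : cdom c q -> transition c c q v = v.
Proof.
move=> cq; rewrite /transition.
have h : is_diff (cmap c q) (cmap c \o cinv c) id.
  apply: near_eq_is_diff (is_diff_id _).
  have io := @cimg_open _ _ _ c.
  apply: (near_open io); first by exists q.
  by move=> _ [r cr <-] /=; rewrite cmapK.
by rewrite (@diff_val _ _ _ _ _ _ _ h).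
Qed.

Lemma transition_comp c d e q v : atlas c -> atlas d -> atlas e ->
  cdom c q -> cdom d q -> cdom e q ->
  transition c e q v = transition d e q (transition c d q v).
Proof.
move=> ac ad ae cq dq eq.
have [_ h] := chart_is_diff ac ad cq dq (transition_differentiable ad ae dq eq).
exact: (congr1 (@^~ v) h).
Qed.

(** On [cdom c] this is the field with constant coordinates [u] in [c], rewritten at each point in
    the preferred chart there. Its values outside [cdom c] carry no meaning. *)
Definition coord_field c (u : 'rV[R]_m) : vector_field M :=
  fun q => transition c (chart_at q) q u.

Lemma chart_coord_field c d u q : atlas c -> atlas d -> cdom c q -> cdom d q ->
  chart_coord d (coord_field c u q : tangent q) = transition c d q u.
Proof.
move=> ac ad cq dq; apply: esym.
exact: (transition_comp u ac (chart_at_atlas q) ad cq (chart_at_dom q) dq).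
Qed.

Lemma chart_coord_id q (v : tangent q) : chart_coord (chart_at q) v = v.
Proof. exact: (transition_id v (chart_at_dom q)). Qed.

Lemma chart_coord_transition c d q (v : tangent q) :
  atlas c -> atlas d -> cdom c q -> cdom d q ->
  chart_coord d v = transition c d q (chart_coord c v).
Proof.
move=> ac ad cq dq.
exact: (transition_comp v (chart_at_atlas q) ac ad (chart_at_dom q) cq dq).
Qed.

Lemma coord_field_coord c q (v : tangent q) : atlas c -> cdom c q ->
  coord_field c (chart_coord c v) q = v.
Proof.
move=> ac cq; apply: etrans (chart_coord_id v).
exact/esym/(chart_coord_transition v ac (chart_at_atlas q) cq (chart_at_dom q)).
Qed.

(* [chart_coord c], [vderiv f] and [pushforward T] are convertible to [mderiv] of
   [cmap c], [f] and [cmap (chart_at (T p)) \o T]. *)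
Definition mderiv (W : normedModType R) (f : M -> W) q : {linear 'rV[R]_m -> W} :=
  'd (f \o cinv (chart_at q)) (cmap (chart_at q) q).

Lemma mderiv_chart (W : normedModType R) (f : M -> W) c q (v : tangent q) :
  atlas c -> cdom c q -> differentiable (f \o cinv c) (cmap c q) ->
  mderiv f q v = 'd (f \o cinv c) (cmap c q) (chart_coord c v).
Proof.
move=> ac cq df.
have [_ h] := chart_is_diff (chart_at_atlas q) ac (chart_at_dom q) cq df.
exact: (congr1 (@^~ v) h).
Qed.

Lemma tangent_coordE c q (v : tangent q) : atlas c -> cdom c q ->
  v = \sum_(k < m) chart_coord c v 0 k *: coord_field c (delta_mx 0 k) q.
Proof.
move=> ac cq; apply: etrans (esym (coord_field_coord v ac cq)) _.
exact: linear_coordE.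
Qed.

Definition smooth_near (W : normedModType R) (p : M) (f : M -> W) : Prop :=
  exists U : set M, [/\ open U, U p & smooth_on U f].

(** One chart suffices to test smoothness: any other chart of the atlas differs from it by a smooth
    transition map. *)
Lemma smooth_nearP (W : normedModType R) c (p : M) (f : M -> W) :
  atlas c -> cdom c p ->
  smooth_near p f <-> exists U : set M,
    [/\ open U, U p, U `<=` cdom c & smooth (cmap c @` U) (f \o cinv c)].
Proof.
move=> ac cp; split=> [[U [Uo Up h]]|[U [Uo Up Uc h]]].
  exists (cdom c `&` U); split=> //; last exact: h.
  exact: openI (cdom_open c) Uo.
exists U; split=> // d ad.
have dUo := @chart_img_open d _ Uo.
apply: (@smooth_eq _ _ _ _ ((f \o cinv c) \o (cmap c \o cinv d))) => //.
  by move=> _ [q [dq Uq] <-] /=; rewrite !cmapK //; exact: Uc.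
apply: (smooth_comp _ _ _ h) => //.
  by move=> _ [q [dq Uq] <-] /=; rewrite cmapK //; exists q.
apply: smooth_sub (atlas_compatible ad ac).
by move=> _ [q [dq Uq] <-]; exists q => //; split=> //; exact: Uc.
Qed.

Lemma cmap_open c (U : set M) : open U -> U `<=` cdom c -> open (cmap c @` U).
Proof.
move=> Uo Uc; have := @chart_img_open c _ Uo.
by rewrite (_ : cdom c `&` U = U) //; apply/setIidPr.
Qed.

Lemma smooth_near_differentiable (W : normedModType R) c (p : M) (f : M -> W) :
  atlas c -> cdom c p -> smooth_near p f ->
  differentiable (f \o cinv c) (cmap c p).
Proof.
move=> ac cp /(smooth_nearP _ ac cp)[U [Uo Up Uc h]].
by apply: smooth_differentiable h _; exists p.
Qed.

Lemma mderiv_component n (f : M -> 'rV[R]_n) (p : M) (v : tangent p) k :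
  smooth_near p f -> mderiv f p v 0 k = vderiv (fun q => f q 0 k : R^o) v.
Proof.
move=> /(smooth_near_differentiable (chart_at_atlas p) (chart_at_dom p)) df.
have dL := linear_differentiable
  ((f \o cinv (chart_at p)) (cmap (chart_at p) p)) (@coordl_continuous R n k).
apply/esym; apply: etrans (congr1 (@^~ v) (diff_comp df dL)) _.
exact: (congr1 (@^~ _) (diff_lin _ (@coordl_continuous R n k))).
Qed.

Lemma smooth_near_eq (W : normedModType R) (p : M) (f g : M -> W) :
  (\forall q \near p, f q = g q) -> smooth_near p f -> smooth_near p g.
Proof.
have ac := chart_at_atlas p; have cp := chart_at_dom p.
move=> /nearE_open[V [Vo Vp fg]] /(smooth_nearP _ ac cp)[U [Uo Up Uc h]].
apply/(smooth_nearP _ ac cp); exists (U `&` V); split=> //.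
- exact: openI.
- by move=> q [/Uc].
have UVc : U `&` V `<=` cdom (chart_at p) by move=> q [/Uc].
apply: smooth_eq (cmap_open (openI Uo Vo) UVc) _ (smooth_sub _ h).
- by move=> _ [q [Uq Vq] <-] /=; rewrite cmapK; [exact: fg|exact: Uc].
- by move=> _ [q [Uq Vq] <-]; exists q.
Qed.

Lemma smooth_near_cst (W : normedModType R) (p : M) (a : W) :
  smooth_near p (fun=> a).
Proof.
exists setT; split=> //; first exact: openT.
by move=> c _ k; exact: classC_cst.
Qed.

Lemma smooth_near2 (W W' : normedModType R) c (p : M) (f : M -> W) (g : M -> W') :
  atlas c -> cdom c p -> smooth_near p f -> smooth_near p g ->
  exists U : set M, [/\ open U, U p, U `<=` cdom c,
    smooth (cmap c @` U) (f \o cinv c) & smooth (cmap c @` U) (g \o cinv c)].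
Proof.
move=> ac cp /(smooth_nearP _ ac cp)[U [Uo Up Uc hf]].
move=> /(smooth_nearP _ ac cp)[V [Vo Vp Vc hg]].
exists (U `&` V); split=> //; first exact: openI.
- by move=> q [/Uc].
- by apply: smooth_sub hf => _ [q [Uq Vq] <-]; exists q.
- by apply: smooth_sub hg => _ [q [Uq Vq] <-]; exists q.
Qed.

Lemma smooth_nearD (W : normedModType R) (p : M) (f g : M -> W) :
  smooth_near p f -> smooth_near p g -> smooth_near p (fun q => f q + g q).
Proof.
have ac := chart_at_atlas p; have cp := chart_at_dom p.
move=> hf hg; have [U [Uo Up Uc sf sg]] := smooth_near2 ac cp hf hg.
apply/(smooth_nearP _ ac cp); exists U; split=> // k.
exact: classCD (cmap_open Uo Uc) (sf k) (sg k).
Qed.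

Lemma smooth_nearZ (W : normedModType R) (p : M) (f : M -> R^o) (g : M -> W) :
  smooth_near p f -> smooth_near p g -> smooth_near p (fun q => f q *: g q).
Proof.
have ac := chart_at_atlas p; have cp := chart_at_dom p.
move=> hf hg; have [U [Uo Up Uc sf sg]] := smooth_near2 ac cp hf hg.
apply/(smooth_nearP _ ac cp); exists U; split=> //.
exact: smooth_scale (cmap_open Uo Uc) sf sg.
Qed.

Lemma smooth_near_coord n (p : M) (f : M -> 'rV[R]_n) i :
  smooth_near p f -> smooth_near p (fun q => f q 0 i : R^o).
Proof.
have ac := chart_at_atlas p; have cp := chart_at_dom p.
move=> /(smooth_nearP _ ac cp)[U [Uo Up Uc h]].
apply/(smooth_nearP _ ac cp); exists U; split=> //.
exact: smooth_coord (cmap_open Uo Uc) h.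
Qed.

(** The chart in [mderiv f q] jumps with [q], so the derivative is first rewritten in the fixed
    chart [c], where [smooth_apply] handles it. *)
Lemma smooth_near_mderiv (W : normedModType R) c (p : M) (f : M -> W)
    (X : vector_field M) :
  atlas c -> cdom c p -> smooth_near p f ->
  smooth_near p (fun q => chart_coord c (X q)) ->
  smooth_near p (fun q => mderiv f q (X q)).
Proof.
move=> ac cp hf hX; have [U [Uo Up Uc sf sX]] := smooth_near2 ac cp hf hX.
apply/(smooth_nearP _ ac cp); exists U; split=> //.
have cUo := cmap_open Uo Uc.
have sL := @smooth_apply R _ m W _ (fun x => 'd (f \o cinv c) x) _ cUo
  (fun v => smooth_diff v sf) sX.
apply: smooth_eq cUo _ sL.
move=> _ [q Uq <-] /=.
rewrite !cmapK; last exact: Uc.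
apply/esym/mderiv_chart => //; first exact: Uc.
by apply: smooth_differentiable sf _; exists q.
Qed.

End Charts.

(** * Fields along a map *)

Section Along.
Variables (R : realType) (m n : nat) (M : manifold R m) (N : manifold R n).
Variable T : M -> N.
Hypothesis sT : smooth_map T.

Lemma preimage_cdom_open (c : chart R n N) : open (T @^-1` cdom c).
Proof. by apply: open_comp (cdom_open c) => x _; exact: sT.1. Qed.

Lemma chart_map_smooth_near (c : chart R n N) (p : M) :
  atlas c -> cdom c (T p) -> smooth_near p (cmap c \o T).
Proof.
move=> ac cp; exists (T @^-1` cdom c); split=> //; last exact: sT.2.
exact: preimage_cdom_open.
Qed.

Lemma chart_coord_pushforward (c : chart R n N) (p : M) (v : tangent p) :
  atlas c -> cdom c (T p) ->
  chart_coord c (Defs.pushforward T v) = mderiv (cmap c \o T) p v.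
Proof.
move=> ac cp.
set d := chart_at p; set e := chart_at (T p).
have ad : atlas d by exact: chart_at_atlas.
have ae : atlas e by exact: chart_at_atlas.
have dp : cdom d p by exact: chart_at_dom.
have ep : cdom e (T p) by exact: chart_at_dom.
have dT : differentiable (cmap e \o T \o cinv d) (cmap d p).
  by apply: smooth_near_differentiable => //; exact: chart_map_smooth_near.
have dt := transition_differentiable ae ac ep cp.
have E : (cmap e \o T \o cinv d) (cmap d p) = cmap e (T p) by rewrite /= cmapK.
have h : is_diff (cmap d p) ((cmap c \o T) \o cinv d)
    ('d (cmap c \o cinv e) (cmap e (T p)) \o 'd (cmap e \o T \o cinv d) (cmap d p)).
  apply: near_eq_is_diff (is_diff_comp_at E dT dt).
  have io := @chart_img_open _ _ _ d _ (@preimage_cdom_open e).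
  apply: (near_open io); first by exists p.
  by move=> _ [r [dr er] <-] /=; rewrite !cmapK.
have [_ hE] := h.
exact/esym/(congr1 (@^~ v) hE).
Qed.

(** Coordinates in another chart [e] arise by applying the Jacobian of the transition, taken at
    [T q], to those in [c]; this Jacobian is smooth in [q] because [T] is. *)
Lemma field_smooth_nearP (c : chart R n N) (p : M) (V : field_along T) :
  atlas c -> cdom c (T p) ->
  field_smooth_near p V <-> smooth_near p (fun q => chart_coord c (V q)).
Proof.
move=> ac cp; split=> [[U [Uo Up h]]|[U [Uo Up h]]].
  exists (U `&` T @^-1` cdom c); split=> //; last exact: h.
  exact: openI Uo (@preimage_cdom_open c).
exists (U `&` T @^-1` cdom c); split; [|by []|].
  exact: openI Uo (@preimage_cdom_open c).
move=> e ae d ad.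
set O := (cmap d @` _).
have Oo : open O.
  apply: chart_img_open; apply: openI (@preimage_cdom_open e).
  exact: openI Uo (@preimage_cdom_open c).
have sV : smooth O ((fun q => chart_coord c (V q)) \o cinv d).
  apply: smooth_sub (h d ad).
  by move=> _ [q [dq [[Uq cq] eq]] <-]; exists q.
have sTO : smooth O (cmap c \o T \o cinv d).
  apply: smooth_sub (sT.2 c ac d ad).
  by move=> _ [q [dq [[Uq cq] eq]] <-]; exists q.
have sL u : smooth O (fun x => 'd (cmap e \o cinv c) (cmap c (T (cinv d x))) u).
  apply: smooth_comp sTO (smooth_diff u (atlas_compatible ac ae)) => //.
  move=> _ [q [dq [[Uq cq] eq]] <-] /=; rewrite cmapK //.
  by exists (T q).
have h' := @smooth_apply R _ n _ _
  (fun x => 'd (cmap e \o cinv c) (cmap c (T (cinv d x)))) _ Oo sL sV.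
apply: smooth_eq Oo _ h'.
move=> _ [q [dq [[Uq cq] eq]] <-] /=; rewrite !cmapK //.
exact/esym/(chart_coord_transition _ ac ae cq eq).
Qed.

Lemma field_smooth_eq (p : M) (V W : field_along T) :
  (\forall q \near p, V q = W q) -> field_smooth_near p V -> field_smooth_near p W.
Proof.
have ac := chart_at_atlas (T p); have cp := chart_at_dom (T p).
move=> VW /(field_smooth_nearP _ ac cp) h; apply/(field_smooth_nearP _ ac cp).
by apply: smooth_near_eq h; apply: filterS VW => q ->.
Qed.

Lemma field_smooth0 (p : M) : field_smooth_near p (fun q => 0 : tangent (T q)).
Proof.
have ac := chart_at_atlas (T p); have cp := chart_at_dom (T p).
apply/(field_smooth_nearP _ ac cp).
apply: smooth_near_eq (smooth_near_cst p 0).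
by apply: nearW => q; exact/esym/linear0.
Qed.

Lemma field_smoothD (p : M) (V W : field_along T) :
  field_smooth_near p V -> field_smooth_near p W ->
  field_smooth_near p (fun q => V q + W q : tangent (T q)).
Proof.
have ac := chart_at_atlas (T p); have cp := chart_at_dom (T p).
move=> /(field_smooth_nearP _ ac cp) hV /(field_smooth_nearP _ ac cp) hW.
apply/(field_smooth_nearP _ ac cp).
apply: smooth_near_eq (smooth_nearD hV hW).
by apply: nearW => q; exact/esym/linearD.
Qed.

Lemma field_smoothZ (p : M) (f : M -> R^o) (V : field_along T) :
  fun_smooth_near p f -> field_smooth_near p V ->
  field_smooth_near p (fun q => f q *: V q : tangent (T q)).
Proof.
have ac := chart_at_atlas (T p); have cp := chart_at_dom (T p).
move=> hf /(field_smooth_nearP _ ac cp) hV.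
apply/(field_smooth_nearP _ ac cp).
apply: smooth_near_eq (smooth_nearZ hf hV).
by apply: nearW => q; exact/esym/linearZ.
Qed.

Lemma field_smooth_sum (p : M) I (r : seq I) (V : I -> field_along T) :
  (forall i, field_smooth_near p (V i)) ->
  field_smooth_near p (fun q => \sum_(i <- r) V i q : tangent (T q)).
Proof.
move=> hV; elim: r => [|i r IH].
  apply: field_smooth_eq (field_smooth0 p).
  by apply: nearW => q; rewrite big_nil.
apply: field_smooth_eq (field_smoothD (hV i) IH).
by apply: nearW => q; rewrite big_cons.
Qed.

Lemma near_cdom (c : chart R n N) (p : M) :
  cdom c (T p) -> \forall q \near p, cdom c (T q).
Proof. by move=> cp; apply: (near_open (@preimage_cdom_open c)). Qed.

Lemma coord_field_smooth (c : chart R n N) (p : M) u : atlas c -> cdom c (T p) ->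
  field_smooth_near p (fun q => coord_field c u (T q)).
Proof.
move=> ac cp; apply/(field_smooth_nearP _ ac cp).
apply: smooth_near_eq (smooth_near_cst p u).
apply: filterS (near_cdom cp) => q cq.
by apply/esym; apply: etrans (chart_coord_field u ac ac cq cq) (transition_id u cq).
Qed.

Lemma smooth_map_chart_component (c : chart R n N) (p : M) k :
  atlas c -> cdom c (T p) ->
  fun_smooth_near p (fun q => cmap c (T q) 0 k : R^o).
Proof. by move=> ac cp; apply: smooth_near_coord (chart_map_smooth_near ac cp). Qed.

End Along.

Lemma smooth_map_id (R : realType) (m : nat) (M : manifold R m) :
  smooth_map (fun q : M => q).
Proof. by split=> [x|c ac d ad] //; exact: atlas_compatible. Qed.

(** * Derivatives along vector fields, and extensions of tangent vectors *)

Section VectorFields.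
Variables (R : realType) (m : nat) (M : manifold R m).

Lemma smooth_near_vderiv (f : M -> R^o) (p : M) (X : vector_field M) :
  fun_smooth_near p f -> vfield_smooth_near p X ->
  fun_smooth_near p (fun q => vderiv f (X q)).
Proof.
have ac := chart_at_atlas p; have cp := chart_at_dom p.
move=> hf /(field_smooth_nearP (smooth_map_id M) X ac cp) hX.
exact: (smooth_near_mderiv ac cp hf hX).
Qed.

Lemma vderiv_near_cst (f : M -> R^o) (p : M) (v : tangent p) a :
  (\forall q \near p, f q = a) -> vderiv f v = 0.
Proof.
move=> /nearE_open[U [Uo Up fa]].
have h : is_diff (cmap (chart_at p) p) (f \o cinv (chart_at p)) 0.
  apply: near_eq_is_diff (is_diff_cst a _).
  have io := @chart_img_open _ _ _ (chart_at p) _ Uo.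
  apply: (near_open io); first by exists p => //; split=> //; exact: chart_at_dom.
  by move=> _ [r [dr Ur] <-] /=; rewrite cmapK // fa.
have [_ hE] := h.
exact: (congr1 (@^~ v) hE).
Qed.

(** The field with constant coordinates [y] in [chart_at p] is a witness, so the default value of
    [xget] never occurs. *)
Lemma extensionP (p : M) (y : tangent p) :
  vfield_smooth_near p (extension y) /\ extension y p = y.
Proof.
have ac := chart_at_atlas p; have cp := chart_at_dom p.
apply: (@xgetPex _ _ [set Y : M -> 'rV[R]_m |
  vfield_smooth_near p (Y : vector_field M) /\ Y p = y]).
exists (coord_field (chart_at p) y); split.
  exact: (coord_field_smooth (smooth_map_id M)).
exact: (transition_id y cp).
Qed.

End VectorFields.

(** * Pushforwards of vector fields *)

Section Pushforward.
Variables (R : realType) (m n : nat) (M : manifold R m) (N : manifold R n).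
Variable T : M -> N.
Hypothesis sT : smooth_map T.

Lemma vderiv_component (c : chart R n N) (p : M) (v : tangent p) k :
  atlas c -> cdom c (T p) ->
  chart_coord c (Defs.pushforward T v) 0 k =
  vderiv (fun q => cmap c (T q) 0 k : R^o) v.
Proof.
move=> ac cp; have h := chart_map_smooth_near sT ac cp.
have E := chart_coord_pushforward sT v ac cp.
exact: etrans (congr1 (fun w : 'rV_n => w 0 k) E) (mderiv_component v k h).
Qed.

Lemma pushforward_smooth (p : M) (X : vector_field M) :
  vfield_smooth_near p X -> field_smooth_near p (fun q => Defs.pushforward T (X q)).
Proof.
have ac := chart_at_atlas (T p); have cp := chart_at_dom (T p).
have ad := chart_at_atlas p; have dp := chart_at_dom p.
move=> /(field_smooth_nearP (smooth_map_id M) X ad dp) hX.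
apply/(field_smooth_nearP sT _ ac cp).
apply: smooth_near_eq (smooth_near_mderiv ad dp (chart_map_smooth_near sT ac cp) hX).
apply: filterS (near_cdom sT cp) => q cq.
exact/esym/(chart_coord_pushforward sT).
Qed.

End Pushforward.

(** * Symmetry of the second fundamental form *)

Section ConnectionSums.
Variables (R : realType) (m n : nat) (M : manifold R m) (N : manifold R n).
Variable T : M -> N.
Hypothesis sT : smooth_map T.
Variable D : covariant_op T.
Arguments D : clear implicits.
Hypothesis hD : is_connection D.

Lemma conn0l (p : M) (V : field_along T) :
  field_smooth_near p V -> D p 0 V = 0.
Proof.
move=> sV; have := conn_linear hD (-1) (0 : tangent p) (0 : tangent p) sV.
by rewrite scaler0 addr0 scaleN1r addNr.
Qed.

Lemma conn_suml (p : M) I (r : seq I) (a : I -> R) (x : I -> tangent p)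
    (V : field_along T) : field_smooth_near p V ->
  D p (\sum_(i <- r) a i *: x i) V = \sum_(i <- r) a i *: D p (x i) V.
Proof.
move=> sV; elim: r => [|i r IH]; first by rewrite !big_nil conn0l.
by rewrite !big_cons -IH; exact: conn_linear.
Qed.

Lemma conn0r (p : M) (x : tangent p) :
  D p x (fun q => 0 : tangent (T q)) = 0.
Proof.
have s0 := field_smooth0 sT p.
have := conn_additive hD x s0 s0.
have -> : (fun q => (0 : tangent (T q)) + 0) = (fun q => 0 : tangent (T q)).
  by apply/funext => q; exact: addr0.
by move=> /(congr1 (fun y => y - D p x (fun q => 0 : tangent (T q))));
  rewrite addrK subrr.
Qed.

Lemma conn_sumr (p : M) (x : tangent p) I (r : seq I) (f : I -> M -> R^o)
    (V : I -> field_along T) :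
  (forall i, fun_smooth_near p (f i)) -> (forall i, field_smooth_near p (V i)) ->
  D p x (fun q => \sum_(i <- r) f i q *: V i q : tangent (T q)) =
  \sum_(i <- r) (vderiv (f i) x *: V i p + f i p *: D p x (V i)).
Proof.
move=> sf sV; have sfV i := field_smoothZ sT (sf i) (sV i).
elim: r => [|i r IH].
  rewrite big_nil -[RHS](conn0r x); congr (D p x _).
  by apply/funext => q; rewrite big_nil.
rewrite big_cons -IH -(conn_leibniz hD x (sf i) (sV i)).
rewrite -(conn_additive hD x (sfV i) (field_smooth_sum sT r sfV)).
by congr (D p x _); apply/funext => q; rewrite big_cons.
Qed.

End ConnectionSums.

(* The components of coordinate fields are constant, so their bracket kills
   every coordinate function. *)
Lemma levi_civita_coord_field_sym (R : realType) (m : nat) (M : manifold R m)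
    (g : metric M) (D : affine_op M) (c : chart R m M) (p : M) (u v : 'rV[R]_m) :
  is_levi_civita g D -> atlas c -> cdom c p ->
  D p (coord_field c u p) (coord_field c v) =
  D p (coord_field c v p) (coord_field c u).
Proof.
move=> hD ac cp; apply/eqP; rewrite -subr_eq0; apply/eqP.
set w : tangent p := _ - _.
have sid := smooth_map_id M.
have su := coord_field_smooth sid u ac cp.
have sv := coord_field_smooth sid v ac cp.
have near_const u' k : \forall q \near p,
    vderiv (fun q => cmap c q 0 k : R^o) (coord_field c u' q) = u' 0 k.
  apply: filterS (near_cdom sid cp) => q cq.
  have s := chart_map_smooth_near sid ac cq.
  have e : chart_coord c (coord_field c u' q : tangent q) = u'.
    exact: etrans (chart_coord_field u' ac ac cq cq) (transition_id u' cq).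
  exact: etrans (esym (mderiv_component _ k s)) (congr1 (fun y : 'rV_m => y 0 k) e).
rewrite (tangent_coordE w ac cp) big1 // => k _.
have s := chart_map_smooth_near sid ac cp.
have -> : chart_coord c w 0 k = 0.
  apply: etrans (mderiv_component w k s) _.
  have sk := smooth_map_chart_component sid k ac cp.
  apply: etrans (lc_torsion_free hD su sv sk) _.
  rewrite (vderiv_near_cst _ (near_const v k)) (vderiv_near_cst _ (near_const u k)).
  exact: subrr.
exact: scale0r.
Qed.

Section SecondFundamentalForm.
Variables (R : realType) (m n : nat) (M1 : manifold R m) (M2 : manifold R n).
Variables (g1 : metric M1) (g2 : metric M2) (T : M1 -> M2).
Variables (D1 : affine_op M1) (D2 : affine_op M2) (DT : covariant_op T).
Arguments D1 : clear implicits.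
Arguments D2 : clear implicits.
Arguments DT : clear implicits.
Hypotheses (sT : smooth_map T).
Hypotheses (hD1 : is_levi_civita g1 D1) (hD2 : is_levi_civita g2 D2).
Hypothesis hDT : is_pullback_connection D2 DT.

(** The chart and its frame are fixed by [p] while the point of evaluation moves; this is why [p]
    and [q] are separate in [pushforwardE]. *)
Let c (p : M1) := chart_at (T p).
Let E (p : M1) k : vector_field M2 := coord_field (c p) (delta_mx 0 k).
Let Tc (p : M1) k : M1 -> R^o := fun q => cmap (c p) (T q) 0 k.

Lemma pushforwardE p q (v : tangent q) : cdom (c p) (T q) ->
  Defs.pushforward T v = \sum_k vderiv (Tc p k) v *: E p k (T q).
Proof.
move=> cq; have ac := chart_at_atlas (T p).
apply: etrans (tangent_coordE (Defs.pushforward T v) ac cq) _.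
apply: eq_bigr => k _; congr (_ *: _).
exact: vderiv_component.
Qed.

Lemma pullback_pushforwardE p (x : tangent p) (Y : vector_field M1) :
  vfield_smooth_near p Y ->
  DT p x (fun q => Defs.pushforward T (Y q)) =
  \sum_k vderiv (fun q => vderiv (Tc p k) (Y q)) x *: E p k (T p) +
  \sum_k \sum_l (vderiv (Tc p k) (Y p) * vderiv (Tc p l) x) *:
      D2 (T p) (E p l (T p)) (E p k).
Proof.
move=> sY.
have ac := chart_at_atlas (T p); have cp := chart_at_dom (T p).
have hC := pullback_connection hDT.
have sTc k : fun_smooth_near p (Tc p k) by exact: smooth_map_chart_component.
have sTY k : fun_smooth_near p (fun q => vderiv (Tc p k) (Y q)).
  exact: smooth_near_vderiv.
have sE k : field_smooth_near p (fun q => E p k (T q)).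
  exact: coord_field_smooth.
have sE2 k : vfield_smooth_near (T p) (E p k).
  exact: (coord_field_smooth (smooth_map_id M2) (delta_mx 0 k) ac cp).
(* The frame expansion holds only while [T q] stays in the chart, so locality is what allows the
   replacement. *)
rewrite (conn_local hC x (pushforward_smooth sT sY) (W := fun q =>
  \sum_k vderiv (Tc p k) (Y q) *: E p k (T q))); last first.
  by apply: filterS (near_cdom sT cp) => q cq; exact: pushforwardE.
rewrite (conn_sumr sT hC x _ sTY sE) big_split /=; congr (_ + _).
apply: eq_bigr => k _.
(* Along [T], the derivative of [E p k] is [D2] in the direction of the pushforward of [x], which is
   expanded in the same frame; this produces the double sum. *)
rewrite (pullback_comp hDT x (sE2 k)) (pushforwardE x cp).
rewrite (conn_suml (lc_connection hD2) _ _ _ (sE2 k)) scaler_sumr.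
by apply: eq_bigr => l _; rewrite scalerA.
Qed.

Lemma sff_field_sym p (X Y : vector_field M1) :
  vfield_smooth_near p X -> vfield_smooth_near p Y ->
  sff_field D1 DT (X p) Y = sff_field D1 DT (Y p) X.
Proof.
move=> sX sY; rewrite /sff_field !pullback_pushforwardE //.
have ac := chart_at_atlas (T p); have cp := chart_at_dom (T p).
have sTc k : fun_smooth_near p (Tc p k) by exact: smooth_map_chart_component.
(* The difference of the two terms is the pushforward of a single vector; its component along
   [E p k] is the bracket of [X] and [Y] tested on [Tc p k]. *)
have tf : Defs.pushforward T (D1 p (X p) Y) - Defs.pushforward T (D1 p (Y p) X) =
    \sum_k vderiv (fun q => vderiv (Tc p k) (Y q)) (X p) *: E p k (T p) -
    \sum_k vderiv (fun q => vderiv (Tc p k) (X q)) (Y p) *: E p k (T p).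
  apply: etrans (esym (linearB _ _ _)) _.
  apply: etrans (pushforwardE _ cp) _.
  rewrite -sumrB; apply: eq_bigr => k _; rewrite -scalerBl; congr (_ *: _).
  by have -> := lc_torsion_free hD1 sX sY (sTc k).
have sy : \sum_k \sum_l (vderiv (Tc p k) (Y p) * vderiv (Tc p l) (X p)) *:
      D2 (T p) (E p l (T p)) (E p k) =
    \sum_k \sum_l (vderiv (Tc p k) (X p) * vderiv (Tc p l) (Y p)) *:
      D2 (T p) (E p l (T p)) (E p k).
  rewrite exchange_big; apply: eq_bigr => k _; apply: eq_bigr => l _ /=.
  rewrite mulrC; congr (_ *: _).
  exact: levi_civita_coord_field_sym hD2 ac cp.
rewrite sy.
have cancel (V : zmodType) (a b s A B : V) : A - B = a - b -> a + s - A = b + s - B.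
  move=> h; rewrite -[a in LHS](subrK b) -h [LHS]addrC [RHS]addrC.
  by rewrite !addrA addNr add0r.
exact: cancel tf.
Qed.

(** Besides symmetry, this supplies linearity in the second argument, which is not visible in the
    arbitrary choice made by [extension]. *)
Lemma second_fundamental_form_sym p (x y : tangent p) :
  second_fundamental_form D1 DT x y = second_fundamental_form D1 DT y x.
Proof.
have [sx ex] := extensionP x; have [sy ey] := extensionP y.
by rewrite /second_fundamental_form -{1}ex -{2}ey; exact: sff_field_sym.
Qed.

Lemma second_fundamental_form_linearl p (a : R) (x y z : tangent p) :
  second_fundamental_form D1 DT (a *: x + y : tangent p) z =
  a *: second_fundamental_form D1 DT x z + second_fundamental_form D1 DT y z.
Proof.
have [sz ez] := extensionP z.
rewrite /second_fundamental_form /sff_field.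
rewrite (conn_linear (pullback_connection hDT) a x y (pushforward_smooth sT sz)).
rewrite (conn_linear (lc_connection hD1) a x y sz).
rewrite (_ : Defs.pushforward T (a *: _ + _ : tangent p) =
  a *: Defs.pushforward T (D1 p x (extension z)) +
  Defs.pushforward T (D1 p y (extension z))); last exact: linearP.
by rewrite scalerBr opprD addrACA.
Qed.

End SecondFundamentalForm.

(** * Isotropic quadratic maps *)

(** Linearity at [x = y = 0] with coefficient 1 gives [g 0 z = 0], after which the second
    coefficient splits off. *)
Lemma form_comb (R : realFieldType) (U : lmodType R) (Z : Type) (g : U -> Z -> R) :
  (forall a x y z, g (a *: x + y) z = a * g x z + g y z) ->
  forall a b x y z, g (a *: x + b *: y) z = a * g x z + b * g y z.
Proof.
move=> gl a b x y z; rewrite gl; congr (_ + _).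
have g0 : g 0 z = 0.
  have := gl 1 0 0 z; rewrite scaler0 addr0 mul1r => /eqP.
  by rewrite addrC -subr_eq subrr => /eqP <-.
by rewrite -[b *: y]addr0 gl g0 addr0.
Qed.

Section IsotropicForms.
Variables (R : realFieldType) (V W : lmodType R).
(** In the application [h] and [k] are the metrics at [p] and [T p], [B] is the second fundamental
    form and [H] is horizontality. *)
Variables (h : V -> V -> R) (k : W -> W -> R) (B : V -> V -> W) (H : V -> Prop).
Hypothesis h_sym : forall x y, h x y = h y x.
Hypothesis h_lin : forall a x y z, h (a *: x + y) z = a * h x z + h y z.
Hypothesis h_pos : forall x, x != 0 -> 0 < h x x.
Hypothesis k_sym : forall x y, k x y = k y x.
Hypothesis k_lin : forall a x y z, k (a *: x + y) z = a * k x z + k y z.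
Hypothesis B_sym : forall x y, B x y = B y x.
Hypothesis B_lin : forall a x y z, B (a *: x + y) z = a *: B x z + B y z.
Hypothesis H_comb : forall a b x y, H x -> H y -> H (a *: x + b *: y).

Lemma kB_comb a b x y v w :
  k (B (a *: x + b *: y) v) w = a * k (B x v) w + b * k (B y v) w.
Proof.
rewrite (form_comb (g := fun x w => k (B x v) w)) // => c x' y' z.
by rewrite B_lin k_lin.
Qed.

Lemma h_comb a b c d x y : h x y = 0 ->
  h (a *: x + b *: y) (c *: x + d *: y) = a * c * h x x + b * d * h y y.
Proof.
move=> xy; rewrite (form_comb h_lin) ![h _ (c *: x + _)]h_sym !(form_comb h_lin).
by rewrite [h y x]h_sym xy; ring.
Qed.

(** The last slot has its own coefficients so that one expansion serves both conditions: [c = a],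
    [d = b] gives the quartic form, and an orthogonal vector gives the other. *)
Lemma kB_comb4 a b c d x y :
  k (B (a *: x + b *: y) (a *: x + b *: y)) (B (a *: x + b *: y) (c *: x + d *: y)) =
  a ^+ 3 * c * k (B x x) (B x x)
  + (3 * a ^+ 2 * b * c + a ^+ 3 * d) * k (B x x) (B x y)
  + (a * b ^+ 2 * c + a ^+ 2 * b * d) *
      (k (B x x) (B y y) + 2 * k (B x y) (B x y))
  + (b ^+ 3 * c + 3 * a * b ^+ 2 * d) * k (B x y) (B y y)
  + b ^+ 3 * d * k (B y y) (B y y).
Proof.
(* Symmetry brings each of the four slots in turn to the front, where it is expanded; the last
   rewrites give equal products one common form. *)
rewrite !kB_comb ![B _ (a *: x + _)]B_sym !kB_comb.
rewrite ![k _ (B (a *: x + _) _)]k_sym !kB_comb.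
rewrite ![B _ (c *: x + _)]B_sym !kB_comb.
rewrite ![B y x]B_sym ![k (B x y) (B x x)]k_sym ![k (B y y) (B x x)]k_sym.
rewrite ![k (B y y) (B x y)]k_sym.
by ring.
Qed.

(* Left to right: compare the coefficients of [t] in the isotropy identity for
   [x] and [x + t y].  Right to left: write [y = s x + z] with [z] orthogonal to
   [x]; the hypothesis for the orthogonal vectors [x + t z] and
   [- t h(z, z) x + h(x, x) z], with [t = 1] and [t = 2], determines the
   remaining coefficients of the quartic. *)
Lemma isotropic_formP :
  (forall x y, H x -> H y -> x != 0 -> y != 0 ->
     k (B x x) (B x x) * h y y ^+ 2 = k (B y y) (B y y) * h x x ^+ 2) <->
  (forall x y, H x -> H y -> h x y = 0 -> k (B x x) (B x y) = 0).
Proof.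
have h_ge0 x : 0 <= h x x.
  have [->|/h_pos/ltW//] := eqVneq x 0.
  by have := form_comb h_lin 0 0 0 0 0; rewrite !scale0r addr0 !mul0r addr0 => ->.
split=> [iso x y Hx Hy xy|orth x y Hx Hy x0 y0].
  (* Isotropy says nothing about the zero vector; there the claim follows from [B] vanishing at
     zero. *)
  have [x0|x0] := eqVneq x 0.
    have := kB_comb 0 0 0 0 x (B x y).
    by rewrite !scale0r !mul0r !addr0 x0.
  have hx := h_pos x0; have hy := h_ge0 y.
  have isot t : k (B x x) (B x x) * (h x x + t ^+ 2 * h y y) ^+ 2 =
      (k (B x x) (B x x) + 4 * t * k (B x x) (B x y)
       + 2 * t ^+ 2 * (k (B x x) (B y y) + 2 * k (B x y) (B x y))
       + 4 * t ^+ 3 * k (B x y) (B y y)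
       + t ^+ 4 * k (B y y) (B y y)) * h x x ^+ 2.
    have hu := h_comb 1 t 1 t xy.
    (* Otherwise [hu] would make [h x x + t ^+ 2 * h y y] zero, although [h x x] is positive. *)
    have u0 : 1 *: x + t *: y != 0.
      apply/eqP => u0; have := h_ge0 (0 *: x + 0 *: y).
      have := form_comb h_lin 0 0 x y 0.
      rewrite !scale0r addr0 !mul0r addr0 => h00 _.
      move: hu; rewrite u0 h00 => hu.
      have : 0 <= t ^+ 2 * h y y by rewrite mulr_ge0 // sqr_ge0.
      by move: hu; lra.
    have := iso _ _ Hx (H_comb 1 t Hx Hy) x0 u0.
    rewrite hu kB_comb4 => e.
    transitivity (k (B x x) (B x x) * (1 * 1 * h x x + t * t * h y y) ^+ 2).
      by ring.
    by rewrite e; ring.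
  (* The left side of [isot] is even in [t], so the odd part on the right vanishes. Its values at 1
     and 2 give two independent linear equations for the coefficients of [t] and [t ^+ 3]. *)
  have e1 := isot 1; have e2 := isot (-1); have e3 := isot 2; have e4 := isot (-2).
  have : k (B x x) (B x y) * h x x ^+ 2 = 0 by lra.
  by move=> /eqP; rewrite mulf_eq0 expf_eq0 (gt_eqF hx) andbF orbF => /eqP.
have hx := h_pos x0.
pose s := h x y / h x x.
pose z := (- s) *: x + 1 *: y.
have Hz : H z by exact: H_comb.
have xz : h x z = 0.
  rewrite h_sym (form_comb h_lin) mul1r mulNr /s divfK ?gt_eqF //.
  by rewrite h_sym addNr.
have yE : y = s *: x + 1 *: z.
  by rewrite /z !scale1r addrA scaleNr subrr add0r.
have ab := orth _ _ Hx Hz xz.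
(* The hypothesis with the roles of [x] and [z] exchanged. *)
have bc : k (B x z) (B z z) = 0.
  by rewrite k_sym B_sym; apply: orth; rewrite // h_sym.
have orth' t : k (B x x) (B x x) * (- (t * h z z))
     + (- (t ^+ 3 * h z z) + t * h x x) *
       (k (B x x) (B z z) + 2 * k (B x z) (B x z))
     + t ^+ 3 * h x x * k (B z z) (B z z) = 0.
  have := orth (1 *: x + t *: z) ((- (t * h z z)) *: x + h x x *: z)
    (H_comb _ _ Hx Hz) (H_comb _ _ Hx Hz).
  rewrite h_comb // kB_comb4 ab bc => e.
  rewrite -[RHS]e; last by ring.
  by ring.
(* The identity is [t] times the difference of the two sides of [e1], plus [t ^+ 3] times that of
   [e2]; two values of [t] make both differences vanish. *)
have o1 := orth' 1; have o2 := orth' 2.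
have e1 : h x x * (k (B x x) (B z z) + 2 * k (B x z) (B x z)) =
    h z z * k (B x x) (B x x) by lra.
have e2 : h x x * k (B z z) (B z z) =
   h z z * (k (B x x) (B z z) + 2 * k (B x z) (B x z)) by lra.
rewrite yE h_comb // kB_comb4 ab bc.
set D := _ + 2 * _ in e1 e2 *.
set A := k (B x x) (B x x) in e1 *; set C := k (B z z) (B z z) in e2 *.
(* This grouping exposes [h x x * D] and [h x x * C], to which [e1] and [e2] apply. Both sides
   become [A] times the square of [s ^+ 2 * h x x + h z z]. *)
transitivity (s ^+ 4 * A * h x x ^+ 2 + 2 * s ^+ 2 * h x x * (h x x * D)
  + h x x * (h x x * C)); last by ring.
rewrite e2 [h x x * (h z z * D)]mulrCA e1.
by ring.
Qed.

End IsotropicForms.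

(** * From isotropy ratios to quartic forms *)

Lemma eqr_sqrt_div (R : rcfType) (a b x y : R) : 0 <= a -> 0 <= b -> 0 < x -> 0 < y ->
  (Num.sqrt a / x = Num.sqrt b / y) <-> (a * y ^+ 2 = b * x ^+ 2).
Proof.
move=> a0 b0 x0 y0.
have -> : (a * y ^+ 2 = b * x ^+ 2) <->
    (Num.sqrt a * y) ^+ 2 = (Num.sqrt b * x) ^+ 2.
  by rewrite !exprMn !sqr_sqrtr.
have xN0 : x != 0 by rewrite gt_eqF.
have yN0 : y != 0 by rewrite gt_eqF.
split=> /eqP h; apply/eqP; move: h; first by rewrite eqr_div // => /eqP ->.
(* Squaring is injective here because both products are nonnegative. *)
by rewrite eqrXn2 ?mulr_ge0 ?sqrtr_ge0 ?(ltW x0) ?(ltW y0) // eqr_div.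
Qed.

Theorem lemma3p1 (R : realType) (m n : nat)
    (M1 : manifold R m) (M2 : manifold R n)
    (g1 : metric M1) (g2 : metric M2) (T : M1 -> M2)
    (D1 : affine_op M1) (D2 : affine_op M2) (DT : covariant_op T)
    (hT : is_riemannian_map g1 g2 T)
    (hD1 : is_levi_civita g1 D1) (hD2 : is_levi_civita g2 D2)
    (hDT : is_pullback_connection D2 DT) (p : M1) :
  h_isotropic g1 g2 D1 DT p <->
  (forall x1 x2 : tangent p,
     horizontal g1 T x1 -> horizontal g1 T x2 -> g1 p x1 x2 = 0 ->
     g2 (T p) (second_fundamental_form D1 DT x1 x1)
              (second_fundamental_form D1 DT x1 x2) = 0).
Proof.
have [sT _ isom] := hT.
have H_comb a b (x y : tangent p) : horizontal g1 T x -> horizontal g1 T y ->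
    horizontal g1 T (a *: x + b *: y : tangent p).
  move=> hx hy w hw; apply: etrans (form_comb (inner_linear (p := p) g1) a b x y w) _.
  by rewrite hx // hy // !mulr0 addr0.
have g2_ge0 (w : tangent (T p)) : 0 <= g2 (T p) w w.
  have [->|/(inner_pos g2)/ltW//] := eqVneq w 0.
  have := form_comb (inner_linear (p := T p) g2) 0 0 0 0 0.
  by rewrite !scale0r addr0 !mul0r addr0 => ->.
apply: iff_trans (isotropic_formP (inner_sym (p := p) g1) (inner_linear (p := p) g1)
  (inner_pos (p := p) g1) (inner_sym (p := T p) g2) (inner_linear (p := T p) g2)
  (second_fundamental_form_sym sT hD1 hD2 hDT (p := p))
  (second_fundamental_form_linearl sT hD1 hDT (p := p)) H_comb).
have ratioE (x y : tangent p) : horizontal g1 T x -> horizontal g1 T y ->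
    x != 0 -> y != 0 ->
    isotropy_ratio g2 D1 DT x = isotropy_ratio g2 D1 DT y <->
    g2 (T p) (second_fundamental_form D1 DT x x) (second_fundamental_form D1 DT x x)
      * g1 p y y ^+ 2 =
    g2 (T p) (second_fundamental_form D1 DT y y) (second_fundamental_form D1 DT y y)
      * g1 p x x ^+ 2.
  move=> hx hy x0 y0.
  (* The isometry property turns the denominators into [g1 p x x] and [g1 p y y], which are positive
     since [x] and [y] are nonzero. *)
  rewrite /isotropy_ratio /vnorm !sqr_sqrtr ?g2_ge0 // !isom //.
  by apply: eqr_sqrt_div => //; exact: inner_pos.
by split=> h x y hx hy x0 y0; apply/(ratioE x y hx hy x0 y0)/h.
Qed.
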